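(* Let $k,M\ge 1$, let $\lambda_1,\dots,\lambda_k\in\mathbb{C}$ (support points), $h_1,\dots,h_k\in\mathbb{C}$ (function values), and let $(z_1,H(z_1)),\dots,(z_M,H(z_M))\in\mathbb{C}\times\mathbb{C}$ be data with $z_i\neq\lambda_j$ for all $i,j$. With $\boldsymbol{p},\boldsymbol{q},n,d,r$, the error functions $E_{\mathrm{Levy}}, E_{\mathrm{SK}}, E_{\mathrm{WF}}$, the Sanathanan-Koerner (SK) and Whitfield (WF) iterations, and the Wirtinger derivative as defined in the context, the following hold. (a) (Levy) For every $\boldsymbol{w}\in\mathbb{C}^k$, the Wirtinger derivative of $E_{\mathrm{Levy}}$ with respect to $\boldsymbol{w}$ is $$\frac{\mathrm{d}E_{\mathrm{Levy}}}{\mathrm{d}\boldsymbol{w}}(\boldsymbol{w})=\sum_{i=1}^{M}\big(\boldsymbol{p}(z_i)-H(z_i)\,\boldsymbol{q}(z_i)\big)\,\overline{\big(n(z_i;\boldsymbol{w})-d(z_i;\boldsymbol{w})H(z_i)\big)}.$$ (b) (SK) If the SK iteration converges, with fixed point $\boldsymbol{w}$ (that is, $\boldsymbol{w}_{(p-1)}=\boldsymbol{w}_{(p)}=\boldsymbol{w}$ for consecutive SK iterates) such that $d(z_i;\boldsymbol{w})\neq0$ for all $i$, then the Wirtinger derivative of $\boldsymbol{v}\mapsto E_{\mathrm{SK}}(\boldsymbol{v};\boldsymbol{w}_{(p-1)})$ with respect to $\boldsymbol{v}$, evaluated at the fixed point $\boldsymbol{v}=\boldsymbol{w}$, is $$\frac{\mathrm{d}E_{\mathrm{SK}}}{\mathrm{d}\boldsymbol{w}}=\sum_{i=1}^{M}\frac{1}{d(z_i;\boldsymbol{w})}\big(\boldsymbol{p}(z_i)-H(z_i)\,\boldsymbol{q}(z_i)\big)\,\overline{\big(r(z_i;\boldsymbol{w})-H(z_i)\big)}.$$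 (c) (WF) If the WF iteration converges, with fixed point $\boldsymbol{w}$ (that is, $\boldsymbol{w}_{(p-1)}=\boldsymbol{w}_{(p)}=\boldsymbol{w}$ for consecutive WF iterates) such that $d(z_i;\boldsymbol{w})\neq0$ for all $i$, then the Wirtinger derivative of $\boldsymbol{v}\mapsto E_{\mathrm{WF}}(\boldsymbol{v};\boldsymbol{w}_{(p-1)})$ with respect to $\boldsymbol{v}$, evaluated at the fixed point $\boldsymbol{v}=\boldsymbol{w}$, is $$\frac{\mathrm{d}E_{\mathrm{WF}}}{\mathrm{d}\boldsymbol{w}}=\sum_{i=1}^{M}\frac{1}{d(z_i;\boldsymbol{w})}\big(\boldsymbol{p}(z_i)-r(z_i;\boldsymbol{w})\,\boldsymbol{q}(z_i)\big)\,\overline{\big(r(z_i;\boldsymbol{w})-H(z_i)\big)}.$$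
   Context: Basis functions: $\boldsymbol{p}(z)=\big[\tfrac{h_1}{z-\lambda_1},\dots,\tfrac{h_k}{z-\lambda_k}\big]^{\mathsf T}\in\mathbb{C}^k$ and $\boldsymbol{q}(z)=\big[\tfrac{1}{z-\lambda_1},\dots,\tfrac{1}{z-\lambda_k}\big]^{\mathsf T}\in\mathbb{C}^k$. For weights $\boldsymbol{w}\in\mathbb{C}^k$: $n(z;\boldsymbol{w})=\boldsymbol{w}^{\mathsf T}\boldsymbol{p}(z)$, $d(z;\boldsymbol{w})=\boldsymbol{w}^{\mathsf T}\boldsymbol{q}(z)$ (plain transpose, no conjugation), and $r(z;\boldsymbol{w})=n(z;\boldsymbol{w})/d(z;\boldsymbol{w})$ where $d(z;\boldsymbol{w})\ne0$ (barycentric form). Error functions, where $\boldsymbol{u}\in\mathbb{C}^k$ denotes the previous weights, held fixed and with $d(z_i;\boldsymbol{u})\neq0$ for all $i$: - Levy: $E_{\mathrm{Levy}}(\boldsymbol{w})=\sum_{i=1}^{M}|n(z_i;\boldsymbol{w})-d(z_i;\boldsymbol{w})H(z_i)|^2$. - SK: $E_{\mathrm{SK}}(\boldsymbol{v};\boldsymbol{u})=\sum_{i=1}^{M}\frac{1}{|d(z_i;\boldsymbol{u})|^2}\,|n(z_i;\boldsymbol{v})-d(z_i;\boldsymbol{v})H(z_i)|^2$. - WF: $E_{\mathrm{WF}}(\boldsymbol{v};\boldsymbol{u})=\sum_{i=1}^{M}\frac{1}{|d(z_i;\boldsymbol{u})|^2}\,\big|n(z_i;\boldsymbol{v})-r(z_i;\boldsymbol{u})d(z_i;\boldsymbol{v})+n(z_i;\boldsymbol{u})-d(z_i;\boldsymbol{u})H(z_i)\big|^2$.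 SK iteration: $\boldsymbol{w}_{(p)}$ is a minimizer of $\boldsymbol{v}\mapsto E_{\mathrm{SK}}(\boldsymbol{v};\boldsymbol{w}_{(p-1)})$ over $\boldsymbol{v}\in\mathbb{C}^k$ with $\|\boldsymbol{v}\|_2=1$; in the first step the previous denominator values $d(z_i;\boldsymbol{w}_{(0)})$ are replaced by $1$. WF iteration: started from given initial weights $\boldsymbol{w}_{(0)}$, $\boldsymbol{w}_{(p)}$ is a minimizer of $\boldsymbol{v}\mapsto E_{\mathrm{WF}}(\boldsymbol{v};\boldsymbol{w}_{(p-1)})$ over $\boldsymbol{v}\in\mathbb{C}^k$ whose first entry equals $1$. In (b) and (c) the previous weights are held fixed when differentiating; only afterwards is the derivative evaluated at the fixed point. Wirtinger derivative: for $f:\mathbb{C}^k\to\mathbb{R}$ that is real-differentiable, with $w_j=x_j+\mathfrak{i}y_j$ ($x_j,y_j\in\mathbb{R}$, $\mathfrak{i}^2=-1$), $\frac{\mathrm{d}f}{\mathrm{d}\boldsymbol{w}}\in\mathbb{C}^k$ is the column vector with entries $\frac12\big(\frac{\partial f}{\partial x_j}-\mathfrak{i}\frac{\partial f}{\partial y_j}\big)$, $j=1,\dots,k$ (equivalently, $\boldsymbol{w}$ and $\overline{\boldsymbol{w}}$ are treated as independent variables). No constraint on the weights is imposed when differentiating. *)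

(* Defs.v *)
From HB Require Import structures.
From mathcomp Require Import all_boot all_order all_algebra.
From mathcomp Require Import all_classical all_reals all_analysis.
From mathcomp Require Import complex.

Set Implicit Arguments.
Unset Strict Implicit.
Unset Printing Implicit Defensive.

Import Order.TTheory GRing.Theory Num.Theory.
Import numFieldNormedType.Exports.

Local Open Scope ring_scope.
Local Open Scope complex_scope.

Section Wirtinger.
Context {R : realType} {k : nat}.

(* [R[i]] is not a normed module over [R] in the library, so C^k is identified
   with R^k x R^k through w = x + i y. *)
Definition of_reim (xy : 'cV[R]_k * 'cV[R]_k) : 'cV[R[i]]_k :=
  \col_j (xy.1 j 0 +i* xy.2 j 0).

Definition to_reim (w : 'cV[R[i]]_k) : 'cV[R]_k * 'cV[R]_k :=
  (\col_j complex.Re (w j 0), \col_j complex.Im (w j 0)).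

Definition real_differentiable (f : 'cV[R[i]]_k -> R) (w : 'cV[R[i]]_k) : Prop :=
  differentiable (f \o of_reim) (to_reim w).

Definition partial_re (f : 'cV[R[i]]_k -> R) (w : 'cV[R[i]]_k) (j : 'I_k) : R :=
  'D_((delta_mx j 0, 0) : 'cV[R]_k * 'cV[R]_k) (f \o of_reim) (to_reim w).

Definition partial_im (f : 'cV[R[i]]_k -> R) (w : 'cV[R[i]]_k) (j : 'I_k) : R :=
  'D_((0, delta_mx j 0) : 'cV[R]_k * 'cV[R]_k) (f \o of_reim) (to_reim w).

Definition wirtinger (f : 'cV[R[i]]_k -> R) (w : 'cV[R[i]]_k) : 'cV[R[i]]_k :=
  \col_j (2^-1 * (partial_re f w j -i* partial_im f w j)).

(* [wirtinger] is total: it is meaningful only where [f] is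
   real-differentiable, hence the first conjunct. *)
Definition is_wirtinger (f : 'cV[R[i]]_k -> R) (w g : 'cV[R[i]]_k) : Prop :=
  real_differentiable f w /\ wirtinger f w = g.

End Wirtinger.

Section Barycentric.
Context {R : realType} {k : nat}.
Implicit Types (lambda h : 'I_k -> R[i]) (s : R[i]) (w : 'cV[R[i]]_k).

Definition pvec lambda h s : 'cV[R[i]]_k := \col_j (h j / (s - lambda j)).

Definition qvec lambda s : 'cV[R[i]]_k := \col_j (1 / (s - lambda j)).

Definition bary_num lambda h s w : R[i] := (w^T *m pvec lambda h s) 0 0.

Definition bary_den lambda s w : R[i] := (w^T *m qvec lambda s) 0 0.

Definition bary lambda h s w : R[i] := bary_num lambda h s w / bary_den lambda s w.

Definition norm2 w : R := Num.sqrt (\sum_(j < k) Normc.normc (w j 0) ^+ 2).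

Definition is_minimizer (S : set 'cV[R[i]]_k) (f : 'cV[R[i]]_k -> R) w : Prop :=
  S w /\ forall v, S v -> f w <= f v.

End Barycentric.

Section Errors.
Context {R : realType} {k M : nat}.
(* [H i] is the datum H(z_i). *)
Implicit Types (lambda h : 'I_k -> R[i]) (z H : 'I_M -> R[i]).
Implicit Types (u v w : 'cV[R[i]]_k).

Definition E_Levy lambda h z H w : R :=
  \sum_(i < M)
    Normc.normc (bary_num lambda h (z i) w - bary_den lambda (z i) w * H i) ^+ 2.

(* The SK error with arbitrary values [e i] in place of d(z_i; u), so as to
   cover the first SK step, where these values are 1. *)
Definition E_SK_den lambda h z H (e : 'I_M -> R[i]) v : R :=
  \sum_(i < M) 1 / Normc.normc (e i) ^+ 2 *
    Normc.normc (bary_num lambda h (z i) v - bary_den lambda (z i) v * H i) ^+ 2.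

Definition E_SK lambda h z H v u : R :=
  E_SK_den lambda h z H (fun i => bary_den lambda (z i) u) v.

Definition E_WF lambda h z H v u : R :=
  \sum_(i < M) 1 / Normc.normc (bary_den lambda (z i) u) ^+ 2 *
    Normc.normc (bary_num lambda h (z i) v
                 - bary lambda h (z i) u * bary_den lambda (z i) v
                 + bary_num lambda h (z i) u
                 - bary_den lambda (z i) u * H i) ^+ 2.

Definition SK_prev_den lambda z (ws : nat -> 'cV[R[i]]_k) (p : nat) (i : 'I_M) : R[i] :=
  if p == 1%N then 1 else bary_den lambda (z i) (ws p.-1).

(* In both iterations the nonvanishing condition says that the error minimized
   at step [p] is well defined. In the SK iteration [ws 0] plays no role. *)
Definition SK_iteration lambda h z H (ws : nat -> 'cV[R[i]]_k) : Prop :=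
  forall p : nat, (0 < p)%N ->
    (forall i : 'I_M, SK_prev_den lambda z ws p i != 0) /\
    is_minimizer [set v | norm2 v = 1]%classic
      (E_SK_den lambda h z H (SK_prev_den lambda z ws p)) (ws p).

Definition WF_iteration (hk : (0 < k)%N) lambda h z H (w0 : 'cV[R[i]]_k)
    (ws : nat -> 'cV[R[i]]_k) : Prop :=
  ws 0%N = w0 /\
  forall p : nat, (0 < p)%N ->
    (forall i : 'I_M, bary_den lambda (z i) (ws p.-1) != 0) /\
    is_minimizer [set v : 'cV[R[i]]_k | v (Ordinal hk) 0 = 1]%classic
      (fun v => E_WF lambda h z H v (ws p.-1)) (ws p).

End Errors.

(* Main.v *)
(* Each error is a sum of terms c |w^T a + b|^2 with c real, and the Wirtinger
   derivative of such a term is c conj(w^T a + b) a: the real differential in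
   the direction v is 2 c Re(conj(w^T a + b) v^T a), and the real and imaginary
   coordinate directions pick out its real part and minus its imaginary part.
   At a fixed point r d = n, so the weight 1/|d|^2 times the conjugate of
   n - d H = d (r - H) is (1/d) conj(r - H). *)
Require Import Defs.
From HB Require Import structures.
From mathcomp Require Import all_boot all_order all_algebra.
From mathcomp Require Import all_classical all_reals all_analysis.
From mathcomp Require Import complex.
From mathcomp Require Import ring.

Set Implicit Arguments.
Unset Strict Implicit.
Unset Printing Implicit Defensive.

Import Order.TTheory GRing.Theory Num.Theory.
Import numFieldNormedType.Exports.

Local Open Scope ring_scope.
Local Open Scope complex_scope.

Lemma normc_sqr (R : rcfType) (s : R[i]) :
  Normc.normc s ^+ 2 = complex.Re s ^+ 2 + complex.Im s ^+ 2.
Proof. by case: s => a b /=; rewrite sqr_sqrtr // addr_ge0 // sqr_ge0. Qed.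

Lemma normc_sqrE (R : rcfType) (s : R[i]) :
  (Normc.normc s ^+ 2)%:C = s * s^*.
Proof.
rewrite normc_sqr; case: s => a b /=; apply/eqP; rewrite eq_complex /=.
by apply/andP; split; apply/eqP; ring.
Qed.

Lemma mulmx_tr_colE (R : pzSemiRingType) (k : nat) (v a : 'cV[R]_k) :
  (v^T *m a) 0 0 = \sum_j v j 0 * a j 0.
Proof. by rewrite mxE; apply: eq_bigr => j _; rewrite mxE. Qed.

Lemma to_reimK (R : realType) (k : nat) :
  cancel (@to_reim R k) (@of_reim R k).
Proof.
by move=> w; apply/colP => j; rewrite !mxE /=; case: (w j 0).
Qed.

Lemma is_diff_linear (R : realType) (V W : normedModType R)
  (f : {linear V -> W}) (x : V) : continuous f -> is_diff x f f.
Proof.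
by move=> cf; apply: DiffDef; [exact: linear_differentiable|rewrite diff_lin].
Qed.

Lemma is_diff_sum (R : realType) (V W : normedModType R) (n : nat)
    (f df : 'I_n -> V -> W) (x : V) :
  (forall i, is_diff x (f i) (df i)) ->
  is_diff x (fun y => \sum_i f i y) (fun y => \sum_i df i y).
Proof.
elim: n f df => [|n IH] f df hf.
  under eq_fun do rewrite big_ord0.
  by apply: is_diff_eq; rewrite funeqE => y; rewrite big_ord0.
under eq_fun do rewrite big_ord_recl.
(* Placed in the context, the induction hypothesis and [hf] serve as instances for the rule on a sum
   of two functions. *)
have ? := IH _ _ (fun i => hf (lift ord0 i)).
by apply: is_diff_eq; rewrite funeqE => y; rewrite big_ord_recl.
Qed.

Section Wirtinger.
Context {R : realType} {k : nat}.
Implicit Types (a w : 'cV[R[i]]_k) (b : R[i]).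
Local Notation E := ('cV[R]_k * 'cV[R]_k)%type.

(** These are the real-linear functionals in which all differentials below are expressed;
    multiplying [a] by a complex scalar rotates the pairing, so no separate functional for imaginary
    parts is needed. *)
Definition Re_pairing a (xy : E) : R := complex.Re (((of_reim xy)^T *m a) 0 0).

Lemma Re_pairingE a xy : Re_pairing a xy =
  \sum_j (xy.1 j 0 * complex.Re (a j 0) - xy.2 j 0 * complex.Im (a j 0)).
Proof.
rewrite /Re_pairing mulmx_tr_colE raddf_sum; apply: eq_bigr => j _.
by rewrite mxE; case: (a j 0).
Qed.

Lemma Re_pairing_is_linear a : linear (Re_pairing a).
Proof.
move=> c u v; rewrite !Re_pairingE scaler_sumr -big_split.
by apply: eq_bigr => j _ /=; rewrite !mxE /GRing.scale /=; ring.
Qed.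

HB.instance Definition _ a :=
  GRing.isLinear.Build R E R *:%R (Re_pairing a) (Re_pairing_is_linear a).

Lemma Re_pairing_continuous a : continuous (Re_pairing a).
Proof.
have -> : Re_pairing a = fun xy => \sum_j
    (xy.1 j 0 * complex.Re (a j 0) - xy.2 j 0 * complex.Im (a j 0)).
  by rewrite funeqE => xy; exact: Re_pairingE.
apply: continuous_big => [|j _ xy]; first exact: add_continuous.
apply: cvgB; apply: cvgMr_tmp.
  exact: (continuous_comp (@cvg_fst _ _ _ _ _) (@coord_continuous _ _ _ _ _ _)).
exact: (continuous_comp (@cvg_snd _ _ _ _ _) (@coord_continuous _ _ _ _ _ _)).
Qed.

(** The squared modulus is a sum of two squares of real affine maps, so the chain rule gives 2 (Re s
    Re s' + Im s Im s') = 2 Re (conj(s) s'), where s is the value at [x] and s' the linear part at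
    [v]. *)
Lemma is_diff_normc_sqr a b (x : E) :
  is_diff x
    (fun xy => Normc.normc (((of_reim xy)^T *m a) 0 0 + b) ^+ 2)
    (fun v => 2 * Re_pairing ((((of_reim x)^T *m a) 0 0 + b)^* *: a) v).
Proof.
have dRe a' : is_diff x (Re_pairing a') (Re_pairing a').
  exact/is_diff_linear/Re_pairing_continuous.
(* The second term uses Im s = Re (- i s). *)
have -> : (fun xy => Normc.normc (((of_reim xy)^T *m a) 0 0 + b) ^+ 2) =
    (Re_pairing a + cst (complex.Re b)) ^+ 2 +
    (Re_pairing (- 'i *: a) + cst (complex.Im b)) ^+ 2.
  rewrite funeqE => xy; rewrite normc_sqr !raddfD /= !fctE /Re_pairing.
  rewrite -scalemxAr [X in _ + (complex.Re X + _) ^+ 2]mxE /=.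
  case: (((of_reim xy)^T *m a) 0 0) => c d /=.
  by ring.
apply: is_diff_eq; rewrite funeqE => v.
rewrite !fctE /= /Re_pairing -!scalemxAr.
rewrite ![(_ *: (_ *m _)) 0 0]mxE.
case: (((of_reim x)^T *m a) 0 0) => c d; case: (((of_reim v)^T *m a) 0 0) => c' d'.
case: b => e f; rewrite /GRing.scale /=.
(* The zero map is the differential of the constants [cst (complex.Re b)] and
   [cst (complex.Im b)]. *)
rewrite (_ : (0 : E -> R) v = 0) //; ring.
Qed.

(** Common form of the three errors: [c] holds the weights, [a] the linear part of each residual,
    [b] its constant part. The coefficient [g] is kept separate so that each case can supply its
    simplified form at [w]. *)
Lemma is_wirtinger_sum_sqr M (c : 'I_M -> R) (a : 'I_M -> 'cV[R[i]]_k)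
    (b g : 'I_M -> R[i]) (f : 'cV[R[i]]_k -> R) w :
  (forall v, f v = \sum_i c i * Normc.normc ((v^T *m a i) 0 0 + b i) ^+ 2) ->
  (forall i, (c i)%:C * ((w^T *m a i) 0 0 + b i)^* = g i) ->
  is_wirtinger f w (\sum_i g i *: a i).
Proof.
move=> fE gE; set e := fun i => ((w^T *m a i) 0 0 + b i)^*.
have df : is_diff (to_reim w) (f \o of_reim)
    (fun v => \sum_i c i *: (2 * Re_pairing (e i *: a i) v)).
  have -> : f \o of_reim = fun xy => \sum_i
      (c i *: (fun xy => Normc.normc (((of_reim xy)^T *m a i) 0 0 + b i) ^+ 2)) xy.
    by rewrite funeqE => xy; rewrite /= fE.
  apply: is_diff_sum => i; apply: is_diffZ.
  by have := is_diff_normc_sqr (a i) (b i) (to_reim w); rewrite to_reimK.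
split; first exact: ex_diff.
have pair_re v j : Re_pairing v (delta_mx j 0, 0) = complex.Re (v j 0).
  rewrite Re_pairingE (bigD1 j) //= big1 => [|l /negPf lj];
    by rewrite !mxE ?lj ?eqxx /= ?mul0r ?mul1r ?subr0 ?addr0.
(* The sign comes from Re (i s) = - Im s. *)
have pair_im v j : Re_pairing v (0, delta_mx j 0) = - complex.Im (v j 0).
  rewrite Re_pairingE (bigD1 j) //= big1 => [|l /negPf lj];
    by rewrite !mxE ?lj ?eqxx /= ?mul0r ?mul1r ?sub0r ?oppr0 ?addr0.
apply/colP => j; rewrite mxE /partial_re /partial_im !deriveE //; try exact: ex_diff.
rewrite !diff_val summxE.
under eq_bigr do rewrite pair_re.
under [in X in _ -i* X]eq_bigr do rewrite pair_im.
set T := fun i => (((c i)%:C * e i) *: a i) j 0.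
under [RHS]eq_bigr do rewrite -gE -/(e _) -/(T _).
have -> : \sum_i c i *: (2 * complex.Re ((e i *: a i) j 0)) =
    2 * complex.Re (\sum_i T i).
  rewrite raddf_sum mulr_sumr; apply: eq_bigr => i _; rewrite /T !mxE /=.
  by case: (e i) => ? ?; case: (a i j 0) => ? ?; rewrite /GRing.scale /=; ring.
have -> : \sum_i c i *: (2 * - complex.Im ((e i *: a i) j 0)) =
    - (2 * complex.Im (\sum_i T i)).
  rewrite raddf_sum mulr_sumr -sumrN; apply: eq_bigr => i _; rewrite /T !mxE /=.
  by case: (e i) => ? ?; case: (a i j 0) => ? ?; rewrite /GRing.scale /=; ring.
(* The partial derivatives are 2 Re S and - 2 Im S with S = [\sum_i T i]; the minus sign in
   [wirtinger] restores 2 S, and the factor 1/2 leaves S. *)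
case: (\sum_i T i) => x y; rewrite opprK.
have -> : 2 * x +i* (2 * y) = 2 * (x +i* y).
  by rewrite !mulr_natl !mulr2n; apply/eqP; rewrite eq_complex /= !eqxx.
by rewrite mulKf ?pnatr_eq0.
Qed.

End Wirtinger.

Section Residuals.
Context {R : realType} {k : nat}.
Context (lambda h : 'I_k -> R[i]) (s : R[i]).
Implicit Types (w : 'cV[R[i]]_k) (t : R[i]).

(** Numerator and denominator are both linear in [w], so for a fixed [t] the residual has no
    constant part. It serves with [t] the datum, and with [t] the previous value of [bary] in the WF
    case. *)
Lemma bary_residual w t :
  bary_num lambda h s w - bary_den lambda s w * t =
  (w^T *m (pvec lambda h s - t *: qvec lambda s)) 0 0.
Proof.
rewrite /bary_num /bary_den mulmxBr -scalemxAr [RHS]mxE; congr (_ + _).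
by rewrite [RHS]mxE [in RHS]mxE mulrC.
Qed.

(** With d the denominator, conj(d) factors out of the conjugated residual and cancels against |d|^2
    = d conj(d). *)
Lemma bary_residual_conj w t : bary_den lambda s w != 0 ->
  (1 / Normc.normc (bary_den lambda s w) ^+ 2)%:C *
    (bary_num lambda h s w - bary_den lambda s w * t)^* =
  1 / bary_den lambda s w * (bary lambda h s w - t)^*.
Proof.
rewrite /bary; set d := bary_den _ _ _; set n := bary_num _ _ _ _ => d0.
have dc0 : d^* != 0 by rewrite conjc_eq0.
have -> : n - d * t = d * (n / d - t) by rewrite mulrBr mulrCA divff ?mulr1.
rewrite (rmorphM (@conjc R)) mulrA !div1r fmorphV /= normc_sqrE.
by rewrite invfM -(mulrA d^-1) mulVf ?mulr1.
Qed.

End Residuals.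

Theorem theorem1 (R : realType) (k M : nat) (hk : (0 < k)%N) (hM : (0 < M)%N)
    (lambda h : 'I_k -> R[i]) (z H : 'I_M -> R[i])
    (hz : forall (i : 'I_M) (j : 'I_k), z i != lambda j) :
  (forall w : 'cV[R[i]]_k,
     is_wirtinger (E_Levy lambda h z H) w
       (\sum_(i < M)
          (bary_num lambda h (z i) w - bary_den lambda (z i) w * H i)^*
            *: (pvec lambda h (z i) - H i *: qvec lambda (z i)))) /\
  (forall (ws : nat -> 'cV[R[i]]_k) (p : nat) (w : 'cV[R[i]]_k),
     SK_iteration lambda h z H ws ->
     (0 < p)%N -> ws p.-1 = w -> ws p = w ->
     (forall i : 'I_M, bary_den lambda (z i) w != 0) ->
     is_wirtinger (fun v => E_SK lambda h z H v (ws p.-1)) w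
       (\sum_(i < M)
          (1 / bary_den lambda (z i) w * (bary lambda h (z i) w - H i)^*)
            *: (pvec lambda h (z i) - H i *: qvec lambda (z i)))) /\
  (forall (w0 : 'cV[R[i]]_k) (ws : nat -> 'cV[R[i]]_k) (p : nat) (w : 'cV[R[i]]_k),
     WF_iteration hk lambda h z H w0 ws ->
     (0 < p)%N -> ws p.-1 = w -> ws p = w ->
     (forall i : 'I_M, bary_den lambda (z i) w != 0) ->
     is_wirtinger (fun v => E_WF lambda h z H v (ws p.-1)) w
       (\sum_(i < M)
          (1 / bary_den lambda (z i) w * (bary lambda h (z i) w - H i)^*)
            *: (pvec lambda h (z i) - bary lambda h (z i) w *: qvec lambda (z i)))).
Proof.
split; [|split].
- move=> w; apply: (@is_wirtinger_sum_sqr _ _ _ (fun=> 1) _ (fun=> 0)) => [v|i].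
    by apply: eq_bigr => i _; rewrite mul1r addr0 bary_residual.
  by rewrite (rmorph1 (real_complex R)) mul1r addr0 bary_residual.
(* Replacing [ws p.-1] by [w] freezes the weights 1/|d|^2 as constants before [v] varies. *)
- move=> ws p w _ _ -> _ d0.
  apply: (@is_wirtinger_sum_sqr _ _ _
    (fun i => 1 / Normc.normc (bary_den lambda (z i) w) ^+ 2) _ (fun=> 0)) => [v|i].
    by apply: eq_bigr => i _; rewrite addr0 bary_residual.
  by rewrite addr0 -bary_residual bary_residual_conj.
move=> w0 ws p w _ _ -> _ d0.
(* The residual at the previous weights does not depend on [v], so it is the constant part. *)
apply: (@is_wirtinger_sum_sqr _ _ _
  (fun i => 1 / Normc.normc (bary_den lambda (z i) w) ^+ 2) _
  (fun i => bary_num lambda h (z i) w - bary_den lambda (z i) w * H i)) => [v|i].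
  apply: eq_bigr => i _.
  by rewrite -bary_residual addrA [bary_den _ _ v * _]mulrC.
(* At [v = w] the linear part is n - (n/d) d = 0, so only the constant part survives, and it is the
   SK residual. *)
rewrite -bary_residual [X in X + _](_ : _ = 0) ?add0r ?bary_residual_conj //.
by rewrite /bary mulrCA divff // mulr1 subrr.
Qed.
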